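(* Let $h=\prod_{i=1}^{t}p_i^{s_i}$ with distinct primes $p_i$, $s_i\ge1$, let $1\le r\le m\le n$, and let $\Sigma_r$ be the complement of $\mathrm{Bil}_r(\mathbb{Z}_h^{m\times n})$. Then $\chi(\Sigma_r)=\omega(\Sigma_r)=\alpha(\mathrm{Bil}_r(\mathbb{Z}_h^{m\times n}))=h^{n(m-r)}$. Moreover, the core of $\Sigma_r$ is a maximum clique of $\Sigma_r$, and $\Sigma_r$ is not a core.
   Context: $\mathbb{Z}_h$ is the residue class ring modulo $h$. The inner rank $\rho(A)$ of a nonzero $A\in\mathbb{Z}_h^{m\times n}$ is the least $r$ with $A=BC$, $B\in\mathbb{Z}_h^{m\times r}$, $C\in\mathbb{Z}_h^{r\times n}$; $\rho(0)=0$. $\mathrm{Bil}_r(\mathbb{Z}_h^{m\times n})$ is the graph on $\mathbb{Z}_h^{m\times n}$, distinct $A,B$ adjacent iff $\rho(A-B)\le r$. $\alpha,\omega,\chi$ denote independence number, clique number and chromatic number. A graph is a core if every endomorphism is an automorphism; a core of a graph $\Gamma$ is a subgraph $\Delta$ that is a core and admits a homomorphism $\Gamma\to\Delta$. *)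

(* Defs.v *)
From HB Require Import structures.
From mathcomp Require Import all_boot all_order all_algebra.
Set Implicit Arguments. Unset Strict Implicit. Unset Printing Implicit Defensive.
Import GRing.Theory.
Local Open Scope ring_scope.

Definition factors_through (R : finNzRingType) (m n : nat) (A : 'M[R]_(m, n)) (r : nat) : bool :=
  [exists B : 'M[R]_(m, r), exists C : 'M[R]_(r, n), A == B *m C].

Lemma factors_through_ex (R : finNzRingType) (m n : nat) (A : 'M[R]_(m, n)) :
  exists r, factors_through A r.
Proof.
exists n; apply/existsP; exists A; apply/existsP; exists 1%:M.
by rewrite mulmx1.
Qed.

Definition inner_rank (R : finNzRingType) (m n : nat) (A : 'M[R]_(m, n)) : nat :=
  if A == 0 then 0%N else ex_minn (factors_through_ex A).

Section Graphs.
Variable V : finType.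

Definition is_clique (e : rel V) (S : {set V}) : bool :=
  [forall x in S, forall y in S, (x != y) ==> e x y].
Definition is_indep (e : rel V) (S : {set V}) : bool :=
  [forall x in S, forall y in S, (x != y) ==> ~~ e x y].

Definition clique_number (e : rel V) : nat :=
  \max_(S : {set V} | is_clique e S) #|S|.
Definition independence_number (e : rel V) : nat :=
  \max_(S : {set V} | is_indep e S) #|S|.

Definition colorable (e : rel V) (k : nat) : bool :=
  [exists f : {ffun V -> 'I_k},
     [forall x, forall y, ((x != y) && e x y) ==> (f x != f y)]].

Lemma colorable_ex (e : rel V) : exists k, colorable e k.
Proof.
exists #|V|; apply/existsP; exists [ffun x => enum_rank x].
apply/forallP => x; apply/forallP => y; apply/implyP => /andP [nxy _].
by rewrite !ffunE; apply: contra nxy => /eqP /enum_rank_inj ->.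
Qed.

Definition chromatic_number (e : rel V) : nat := ex_minn (colorable_ex e).

Definition is_hom (e e' : rel V) (f : V -> V) : Prop :=
  forall x y, e x y -> e' (f x) (f y).

Definition is_aut (e : rel V) (f : V -> V) : Prop :=
  bijective f /\ {mono f : x y / e x y}.

Definition is_core_graph (e : rel V) : Prop :=
  forall f : V -> V, is_hom e e f -> is_aut e f.

Definition is_subgraph (e : rel V) (S : {set V}) (e' : rel V) : Prop :=
  (forall x y, e' x y -> [&& x \in S, y \in S & e x y]) /\ symmetric e'.

Definition subgraph_is_core (S : {set V}) (e' : rel V) : Prop :=
  forall f : V -> V, (forall x, x \in S -> f x \in S) -> is_hom e' e' f ->
    [/\ {in S &, injective f}, S \subset f @: S &
        {in S &, forall x y, e' (f x) (f y) = e' x y}].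

Definition is_core_of (e : rel V) (S : {set V}) (e' : rel V) : Prop :=
  [/\ is_subgraph e S e', subgraph_is_core S e' &
      exists phi : V -> V, (forall x, phi x \in S) /\ is_hom e e' phi].

End Graphs.

Definition Bil (h m n r : nat) : rel 'M['Z_h]_(m, n) :=
  fun A B => (A != B) && (inner_rank (A - B) <= r)%N.

Definition Sigma (h m n r : nat) : rel 'M['Z_h]_(m, n) :=
  fun A B => (A != B) && ~~ @Bil h m n r A B.
Arguments Bil h m n r : clear implicits.
Arguments Sigma h m n r : clear implicits.

(* Main.v *)
(* Everything reduces to a clique of size h^(n(m-r)) in Sigma_r, since the map
   sending a matrix to its last m-r rows is a proper colouring of Sigma_r with
   that many colours: two matrices with the same last m-r rows differ by a
   product through r coordinates.  The colouring composed with the clique is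
   then a retraction of Sigma_r onto the clique, which determines the core.

   Such a clique is a "maximum rank distance" code.  Over F_p one takes the
   Gabidulin code: the F_p-linear maps x |-> sum_(i < m-r) a_i x^(p^i) on
   F_(p^n), which have small kernels because they are polynomials of small
   degree.  A generator matrix G over the integers that reduces to a Gabidulin
   generator matrix modulo every prime divisor of h generates the code over
   Z_h.  Indeed, suppose that c G = B C mod h with B having r columns, and let
   g = gcd(h, c).  By the Smith normal form of B there is an integer matrix X
   with m-r rows, right invertible, with X B = 0; so h | X (c G), whence
   h/g | X ((c/g) G).  For a prime p | h/g the Gabidulin property gives
   p | c/g, contradicting the choice of g; hence h/g = 1 and c = 0 mod h. *)
Require Import Defs.
From HB Require Import structures.
From mathcomp Require Import all_boot all_order all_algebra all_field.

Set Implicit Arguments.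
Unset Strict Implicit.
Unset Printing Implicit Defensive.

Import GRing.Theory.

(** * Graphs properly coloured with as many colours as a clique has vertices *)

Lemma chromatic_numberP (V : finType) (e : rel V) k :
  colorable e k -> (forall j, colorable e j -> k <= j) ->
  chromatic_number e = k.
Proof.
rewrite /chromatic_number => ck mink; case: ex_minnP => j cj minj.
by apply/eqP; rewrite eqn_leq minj // mink.
Qed.

Section CliqueColoring.

Variables (V : finType) (e : rel V) (K : {set V}) (c : V -> 'I_#|K|).
Hypotheses (e_irr : irreflexive e) (K_clique : is_clique e K).
Hypothesis c_proper : forall x y, e x y -> c x != c y.

Lemma cliqueP (S : {set V}) :
  reflect {in S &, forall x y, x != y -> e x y} (is_clique e S).
Proof.
apply: (iffP forall_inP) => [cS x y xS yS neq_xy | cS x xS].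
  by have /forall_inP/(_ y yS)/implyP/(_ neq_xy) := cS x xS.
by apply/forall_inP => y yS; apply/implyP; apply: cS.
Qed.

Let retract x : V := enum_val (c x).

Lemma retract_hom x y : e x y ->
  [/\ retract x \in K, retract y \in K & retract x != retract y].
Proof.
by move=> /c_proper neq_c; rewrite !enum_valP (inj_eq enum_val_inj).
Qed.

Lemma proper_coloring_inj (S : {set V}) k (f : V -> 'I_k) : is_clique e S ->
  (forall x y, e x y -> f x != f y) -> {in S &, injective f}.
Proof.
move=> /cliqueP cS f_proper x y xS yS eq_f.
apply/eqP; apply/negPn/negP => neq_xy.
by have := f_proper _ _ (cS _ _ xS yS neq_xy); rewrite eq_f eqxx.
Qed.

Lemma clique_leq_colors (S : {set V}) k : is_clique e S -> colorable e k ->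
  #|S| <= k.
Proof.
move=> cS /existsP[f /forallP f_proper].
rewrite -(card_in_imset (@proper_coloring_inj S k f cS _)).
  by rewrite -[k in _ <= k]card_ord max_card.
move=> x y exy; have /forallP/(_ y)/implyP := f_proper x; apply.
rewrite exy andbT.
by apply: contraTneq exy => ->; rewrite e_irr.
Qed.

Lemma colorable_clique : colorable e #|K|.
Proof.
apply/existsP; exists (finfun c); apply/forallP => x; apply/forallP => y.
by apply/implyP => /andP[_ /c_proper]; rewrite !ffunE.
Qed.

Lemma chromatic_number_clique : chromatic_number e = #|K|.
Proof.
by apply: chromatic_numberP colorable_clique _ => j; apply: clique_leq_colors.
Qed.

Lemma clique_number_clique : clique_number e = #|K|.
Proof.
apply/eqP; rewrite eqn_leq; apply/andP; split; last first.
  exact: (leq_bigmax_cond (F := fun S : {set V} => #|S|)).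
by apply/bigmax_leqP => S cS; apply: clique_leq_colors colorable_clique.
Qed.

(** An endomorphism of a complete graph without loops is injective, and [K] is finite, so it
    permutes [K]. *)
Lemma clique_is_core : V -> is_core_of e K [rel x y in K | x != y].
Proof.
move=> x0; split.
- split=> [x y /= /andP[/andP[xK yK] neq_xy] | x y /=].
    by rewrite xK yK (cliqueP _ K_clique).
  by rewrite [_ && (y \in K)]andbC eq_sym.
- move=> f fK f_hom; have f_inj : {in K &, injective f}.
    move=> x y xK yK eq_f; apply/eqP; apply/negPn/negP => neq_xy.
    have : [&& x \in K, y \in K & x != y] by rewrite xK yK.
    by rewrite andbA => /f_hom/andP[_]; rewrite eq_f eqxx.
  have fKK : f @: K = K.
    apply/eqP; rewrite eqEcard card_in_imset // leqnn andbT.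
    by apply/subsetP => _ /imsetP[x xK ->]; apply: fK.
  split=> [//||x y xK yK /=]; first by rewrite fKK.
  by rewrite !fK // xK yK (inj_in_eq f_inj).
exists retract; split=> [x | x y /retract_hom[xK yK neq_xy]].
  exact: enum_valP.
by rewrite /= xK yK.
Qed.

Lemma core_is_max_clique S e' : is_core_of e S e' ->
  {in S &, forall x y, x != y -> e' x y} /\ #|S| = clique_number e.
Proof.
case=> [[sub_e' _] e'_core [phi [phiS phi_hom]]].
have phiK : {in K &, forall x y, x != y -> e' (phi x) (phi y)}.
  by move=> x y xK yK neq_xy; apply/phi_hom/(cliqueP _ K_clique).
(* [phi \o retract] is an endomorphism of the core, hence onto [S], and it factors through [K]. *)
have [_ S_sub _] : [/\ {in S &, injective (phi \o retract)},
    S \subset (phi \o retract) @: S & {in S &, forall x y,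
    e' ((phi \o retract) x) ((phi \o retract) y) = e' x y}].
  apply: e'_core => [x _ | x y /sub_e'/and3P[_ _ /retract_hom[xK yK neq_xy]]].
    exact: phiS.
  exact: phiK.
have S_phiK : S = phi @: K.
  apply/eqP; rewrite eqEsubset; apply/andP; split.
    apply: subset_trans S_sub _; apply/subsetP => _ /imsetP[x _ ->].
    by apply: imset_f; apply: enum_valP.
  by apply/subsetP => _ /imsetP[x _ ->].
have phi_inj : {in K &, injective phi}.
  move=> x y xK yK eq_phi; apply/eqP; apply/negPn/negP => neq_xy.
  by have /sub_e'/and3P[_ _] := phiK x y xK yK neq_xy; rewrite eq_phi e_irr.
split; last by rewrite clique_number_clique S_phiK card_in_imset.
move=> x y; rewrite S_phiK => /imsetP[u uK ->] /imsetP[v vK ->] neq_uv.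
by apply: phiK => //; apply: contraNneq neq_uv => ->.
Qed.

(** [retract] is an endomorphism with too few values to be injective. *)
Lemma small_clique_not_core : #|K| < #|V| -> ~ is_core_graph e.
Proof.
move=> lt_KV e_core; have [retract_bij _] : is_aut e retract.
  apply: e_core => x y /retract_hom[xK yK neq_xy].
  exact: (cliqueP _ K_clique).
have /leq_card : injective c.
  by move=> x y eq_c; apply: (bij_inj retract_bij); rewrite /retract eq_c.
by rewrite card_ord leqNgt lt_KV.
Qed.

End CliqueColoring.

Local Open Scope ring_scope.

(** * Gabidulin codes over a prime field *)

Section Gabidulin.
Import VectorInternalTheory.

Variables (p : nat) (L : fieldExtType 'F_p) (m k : nat).
Hypothesis p_prime : prime p.
Local Notation n := (dim L).
Hypothesis le_mn : (m <= n)%N.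
Implicit Types (a : 'M['F_p]_(k, n)) (X : 'M['F_p]_(k, m)).

(** The rows of [a] are the coordinate vectors of the coefficients in [L]. *)
Definition linearized_poly a (x : L) : L :=
  \sum_(i < k) r2v (row i a) * x ^+ (p ^ i).

Lemma linearized_poly_linear a : linear (linearized_poly a).
Proof.
have pL : p \in [pchar L] by rewrite pchar_lalg pchar_Fp.
move=> c x y; rewrite scaler_sumr -big_split; apply: eq_bigr => i _ /=.
have cp : c ^+ (p ^ i) = c.
  elim: (nat_of_ord i) => [|j IHj]; first by rewrite expr1.
  by rewrite expnSr exprM IHj -[X in _ ^+ X](card_Fp p_prime) expf_card.
rewrite exprDn_pchar ?exprZn ?cp ?mulrDr ?scalerAr //.
by rewrite pnatX (eq_pnat _ (pcharf_eq pL)) pnat_id.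
Qed.

HB.instance Definition _ a :=
  GRing.isLinear.Build 'F_p L L _ (linearized_poly a)
    (linearized_poly_linear a).

Lemma linearized_poly_linearl x : linear (fun a => linearized_poly a x).
Proof.
move=> c a b; rewrite scaler_sumr -big_split; apply: eq_bigr => i _ /=.
by rewrite !linearP /= mulrDl scalerAl.
Qed.

(** The factor [pid_mx m] keeps the first [m] rows, restricting the map to the span of the first [m]
    basis vectors of [L]. *)
Definition gabidulin_mx a : 'M['F_p]_(m, n) :=
  pid_mx m *m lin1_mx (fun v => v2r (linearized_poly a (r2v v))).

Lemma gabidulin_mx_linear : linear gabidulin_mx.
Proof.
move=> c a b; rewrite /gabidulin_mx scalemxAr -mulmxDr; congr (_ *m _).
by apply/matrixP => i j; rewrite !mxE linearized_poly_linearl linearP !mxE.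
Qed.

HB.instance Definition _ := GRing.isLinear.Build 'F_p
  'M_(k, n) 'M_(m, n) _ gabidulin_mx gabidulin_mx_linear.

(* The rows of [X] span p^k roots of a polynomial of degree at most p^(k-1). *)
Lemma gabidulin_mx_kernel a X : row_free X -> X *m gabidulin_mx a = 0 -> a = 0.
Proof.
move=> freeX Xa0; case: (posnP k) => [k0 | k_gt0].
  by apply/matrixP => i; have := ltn_ord i; rewrite {2}k0.
have p_gt1 := prime_gt1 p_prime.
(* [u *m X] is padded with zeros to length [n] and read in [L]; this yields [p ^ k] distinct
   roots. *)
pose x (u : 'rV['F_p]_k) : L := r2v (u *m X *m pid_mx m).
have x_inj : injective x.
  move=> u v /r2v_inj H; apply: (row_free_inj freeX); move: H.
  by apply: row_free_inj; rewrite /row_free rank_pid_mx.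
have root_x u : linearized_poly a (x u) = 0.
  apply/v2r_inj; rewrite linear0.
  pose h := fun v => v2r (linearized_poly a (r2v v)).
  have h_lin : linear h by move=> c v w; rewrite /h !linearP.
  pose hl : {linear _ -> _} := HB.pack h (GRing.isLinear.Build _ _ _ _ h h_lin).
  rewrite -[LHS]/(hl _) -mul_rV_lin1 -!mulmxA.
  by rewrite -[pid_mx m *m _]/(gabidulin_mx a) Xa0 mulmx0.
pose P : {poly L} := \sum_(i < k) r2v (row i a) *: 'X^(p ^ i).
have P0 : P = 0.
  apply/eqP; apply/negPn/negP => /max_poly_roots/(_ (_ : all _ (codom x))).
  rewrite map_inj_uniq ?enum_uniq // size_map -cardE card_mx card_Fp // mul1n.
  suff leP : (size P <= p ^ k)%N.
    move=> /(_ _ isT); rewrite ltnNge leP => H; apply/notF/H.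
    apply/allP => _ /codomP[u ->]; rewrite rootE horner_sum.
    under eq_bigr do rewrite hornerZ hornerXn.
    by rewrite -/(linearized_poly a _) root_x.
  apply: (big_ind (fun q : {poly L} => (size q <= p ^ k)%N)).
  - by rewrite size_poly0.
  - by move=> q q' lq lq'; rewrite (leq_trans (size_polyD _ _)) // geq_max lq.
  move=> i _; rewrite (leq_trans (size_scale_leq _ _)) // size_polyXn.
  by rewrite ltn_exp2l.
(* The exponents [p ^ i] are distinct, so row [i] of [a] is recovered from the coefficient of [P] at
   [p ^ i]. *)
apply/row_matrixP => i; rewrite row0; apply/r2v_inj; rewrite linear0.
have <- : P`_(p ^ i) = 0 by rewrite P0 coef0.
rewrite coef_sum (bigD1 i) //= coefZ coefXn eqxx mulr1 big1 ?addr0 //.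
move=> j neq_ji; rewrite coefZ coefXn eqn_exp2l // (inj_eq val_inj) eq_sym.
by rewrite (negbTE neq_ji) mulr0.
Qed.

End Gabidulin.

Lemma mrd_code_Fp p m n k : prime p -> (0 < n)%N -> (m <= n)%N ->
  exists G : 'M['F_p]_(k * n, m * n), forall (c : 'rV_(k * n)) (X : 'M_(k, m)),
    row_free X -> X *m vec_mx (c *m G) = 0 -> c = 0.
Proof.
move=> p_prime n_gt0 le_mn.
have [F pF cardF] := pPrimePowerField p_prime n_gt0.
pose L : fieldExtType 'F_p := pPrimeCharType pF.
have En : n = dim L by rewrite -dimvf pprimeChar_dimf cardF pfactorK.
(* Generalizing [L] allows [n] to be replaced by [dim L]. *)
move: (L) En => {F pF cardF}L En; subst n.
exists (lin_mx (@gabidulin_mx p L m k)) => c X freeX.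
rewrite -{1}[c]vec_mxK mul_vec_lin mxvecK.
move=> /(gabidulin_mx_kernel p_prime le_mn freeX) c0.
by rewrite -[c]vec_mxK c0 linear0.
Qed.

(** * Integer lifts, from prime fields to the integers modulo [h] *)

Lemma intr_Zp_eq0 h (z : int) : (1 < h)%N -> (z%:~R == 0 :> 'Z_h) = (h %| z)%Z.
Proof.
move=> h_gt1; have natE k : (k%:R == 0 :> 'Z_h) = (h %| k)%N.
  by rewrite -val_eqE /= val_Zp_nat.
case: z => k; first by rewrite natE.
by rewrite NegzE intrN oppr_eq0 natE dvdzE abszN.
Qed.

Lemma intr_Fp_eq0 p (z : int) : prime p -> (z%:~R == 0 :> 'F_p) = (p %| z)%Z.
Proof. by move=> p_prime; rewrite (dvdz_pcharf (pchar_Fp p_prime)). Qed.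

Lemma map_mx_intr_Zp_surj h m n (A : 'M['Z_h]_(m, n)) :
  exists B : 'M[int]_(m, n), map_mx intr B = A.
Proof.
exists (\matrix_(i, j) (A i j : nat)%:Z).
by apply/matrixP => i j; rewrite !mxE -[RHS]natr_Zp.
Qed.

Lemma crt_mx_primes m n (s : seq nat) (P : forall p, 'M['F_p]_(m, n) -> Prop) :
  uniq s -> all prime s -> {in s, forall p, exists G, P p G} ->
  exists A : 'M[int]_(m, n), {in s, forall p, P p (map_mx intr A)}.
Proof.
elim: s => [|p s IHs] /=; first by exists 0.
move=> /andP[p_s uniq_s] /andP[p_prime s_prime] exG.
have [|A A_P] := IHs uniq_s s_prime.
  by move=> l l_s; apply: exG; rewrite inE l_s orbT.
have [G PG] := exG p (mem_head p s).
pose q := (\prod_(i <- s) i)%N.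
have pq : coprimez p q.
  rewrite coprimezE /= prime_coprime // Euclid_dvd_prod // big_has.
  apply: contra p_s => /hasP[i i_s].
  by rewrite dvdn_prime2 ?(allP s_prime i i_s) // => /eqP ->.
have [B BG] : exists B : 'M[int]_(m, n), map_mx intr B = G.
  exact: map_mx_intr_Zp_surj.
have [u [v uv]] := Bezoutz p q.
have uv1 : u * p%:Z + v * q%:Z = 1 by rewrite uv (eqP pq).
(* Chinese remaindering: by Bezout, [u * p] is 0 modulo [p] and 1 modulo each prime in [s], and
   [v * q] the reverse. *)
exists (u * p%:Z *: A + v * q%:Z *: B) => l; rewrite inE => /predU1P[-> | l_s].
  have p0 : (u * p%:Z)%:~R = 0 :> 'F_p.
    by apply/eqP; rewrite intr_Fp_eq0 // dvdz_mull.
  have q1 : (v * q%:Z)%:~R = 1 :> 'F_p.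
    by rewrite -[RHS]/(1%:~R) -[in RHS]uv1 intrD p0 add0r.
  by rewrite map_mxD !map_mxZ /= p0 q1 BG scale0r add0r scale1r.
have l_prime := allP s_prime l l_s.
have q0 : (v * q%:Z)%:~R = 0 :> 'F_l.
  apply/eqP; rewrite intr_Fp_eq0 // dvdz_mull // /q (big_rem l l_s) /=.
  by rewrite PoszM dvdz_mulr.
have p1 : (u * p%:Z)%:~R = 1 :> 'F_l.
  by rewrite -[RHS]/(1%:~R) -[in RHS]uv1 intrD q0 addr0.
by rewrite map_mxD !map_mxZ /= q0 p1 scale0r addr0 scale1r; apply: A_P.
Qed.

(** In the Smith form [L *m D *m R] of [B] the last [k] rows of [D] vanish, so the last [k] rows of
    the inverse of [L] annihilate [B]. The last [k] columns of [L] form their right inverse. *)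
Lemma int_left_kernel r k (B : 'M[int]_(r + k, r)) :
  exists X : 'M[int]_(k, r + k), X *m B = 0 /\ exists Y, X *m Y = 1%:M.
Proof.
have [L L_unit [R _ [d _ ->]]] := int_Smith_normal_form B.
exists (dsubmx (invmx L)); split; last first.
  exists (rsubmx L); rewrite mul_dsub_mx mulmx_rsub mulVmx //.
  by apply/matrixP => i j; rewrite !mxE (inj_eq (@rshift_inj _ _)).
rewrite mul_dsub_mx !mulmxA mulVmx // mul1mx -mul_dsub_mx.
suff -> : dsubmx (\matrix_(i < r + k, j < r) (d`_i *+ (i == j :> nat))) = 0.
  by rewrite mul0mx.
apply/matrixP => i j; rewrite !mxE /= gtn_eqF //.
exact: ltn_addr.
Qed.

Lemma map_mx_intr_Zp_eq0 h m n (A : 'M[int]_(m, n)) : (1 < h)%N ->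
  map_mx intr A = 0 :> 'M['Z_h]_(m, n) <-> forall i j, (h %| A i j)%Z.
Proof.
move=> h_gt1; split=> [/matrixP A0 i j | hA].
  by rewrite -intr_Zp_eq0 //; have := A0 i j; rewrite !mxE => ->.
by apply/matrixP => i j; rewrite !mxE; apply/eqP; rewrite intr_Zp_eq0.
Qed.

Lemma map_mx_intr_Fp_eq0 p m n (A : 'M[int]_(m, n)) : prime p ->
  map_mx intr A = 0 :> 'M['F_p]_(m, n) <-> forall i j, (p %| A i j)%Z.
Proof.
move=> p_prime; split=> [/matrixP A0 i j | pA].
  by rewrite -intr_Fp_eq0 //; have := A0 i j; rewrite !mxE => ->.
by apply/matrixP => i j; rewrite !mxE; apply/eqP; rewrite intr_Fp_eq0.
Qed.

Lemma mrd_code_Zp h r k n : (1 < h)%N -> (0 < n)%N -> (r + k <= n)%N ->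
  exists G : 'M['Z_h]_(k * n, (r + k) * n),
    forall (c : 'rV_(k * n)) (B : 'M_(r + k, r)) (C : 'M_(r, n)),
    vec_mx (c *m G) = B *m C -> c = 0.
Proof.
move=> h_gt1 n_gt0 le_n; have h_gt0 := ltnW h_gt1.
have [|G GP] := @crt_mx_primes (k * n) ((r + k) * n) (primes h)
  (fun p G => forall (c : 'rV_(k * n)) (X : 'M_(k, r + k)),
     row_free X -> X *m vec_mx (c *m G) = 0 -> c = 0)
  (primes_uniq h) (all_prime_primes h).
  by move=> p; rewrite mem_primes => /andP[p_prime _]; apply: mrd_code_Fp.
exists (map_mx intr G) => c0 B0 C0.
have [c <-] := map_mx_intr_Zp_surj c0; have [B <-] := map_mx_intr_Zp_surj B0.
have [C <-] := map_mx_intr_Zp_surj C0.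
rewrite -!map_mxM -map_vec_mx /= => cG_BC.
(* The gcd of [h] and all entries of [c]; the claim amounts to [g = h]. *)
pose g := gcdn h (\big[gcdn/0]_i `|c 0%R i|)%N.
have g_h : (g %| h)%N by apply: dvdn_gcdl.
have g_gt0 : (0 < g)%N by rewrite gcdn_gt0 h_gt0.
have g_c i : (g %| c 0%R i)%Z.
  by rewrite dvdzE; apply: dvdn_trans (dvdn_gcdr _ _) (biggcdn_inf i _ _).
apply/map_mx_intr_Zp_eq0 => //.
have [d_gt1 | d_le1] := ltnP 1 (h %/ g); last first.
  have hg1 : (h %/ g = 1)%N.
    by apply/eqP; rewrite eqn_leq d_le1 divn_gt0 // dvdn_leq.
  have h_g : (h %| g)%N by rewrite -[X in (X %| _)%N](divnK g_h) hg1 mul1n.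
  by move=> i j; rewrite ord1; apply: dvdz_trans (g_c j).
pose p := pdiv (h %/ g); have p_prime : prime p by apply: pdiv_prime.
have pg_h : (p * g %| h)%N by rewrite -(divnK g_h) dvdn_pmul2r // pdiv_dvd.
pose c' := \row_i (c 0%R i %/ g)%Z.
have c_gc' : c = g%:Z *: c'.
  by apply/rowP => i; rewrite !mxE mulrC divzK.
have [X [XB0 [Y XY1]]] := int_left_kernel B.
have c'0 : map_mx intr c' = 0 :> 'rV['F_p]_(k * n).
  apply: (GP p _ _ (map_mx intr X)).
  - by rewrite mem_primes p_prime h_gt0 (dvdn_trans _ pg_h) ?dvdn_mulr.
  - by apply/row_freeP; exists (map_mx intr Y); rewrite -map_mxM XY1 map_mx1.
  rewrite -map_mxM -map_vec_mx -map_mxM; apply/map_mx_intr_Fp_eq0 => // i j.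
  (* The codeword of [c = g *: c'] is [B *m C] modulo [h], and [X] annihilates [B]. As [p * g]
     divides [h], cancelling [g] leaves divisibility by [p]. *)
  have : map_mx intr (g%:Z *: (X *m vec_mx (c' *m G))) = 0 :> 'M['Z_h]_(k, n).
    rewrite scalemxAr -linearZ /= scalemxAl -c_gc' map_mxM cG_BC.
    by rewrite map_mxM mulmxA -map_mxM XB0 map_mx0 mul0mx.
  move/map_mx_intr_Zp_eq0 => /(_ h_gt1 i j); rewrite mxE => h_gXc.
  rewrite -(@dvdz_mul2l g) -?lt0n //; apply: dvdz_trans h_gXc.
  by rewrite -PoszM mulnC.
(* [p * g] divides [h] and every entry of [c], hence their gcd [g], which is absurd. *)
have /(dvdn_leq g_gt0) : (p * g %| g)%N.
  rewrite dvdn_gcd pg_h; apply/dvdn_biggcdP => i _.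
  have /(map_mx_intr_Fp_eq0 _ p_prime)/(_ 0 i) := c'0.
  by rewrite c_gc' !mxE abszM [X in (X %| _)%N]mulnC dvdn_pmul2l.
by rewrite -[X in (_ <= X)%N]mul1n leq_pmul2r // leqNgt prime_gt1.
Qed.

(** * Inner rank, and the clique and colouring of [Sigma] *)

Lemma inner_rank_leP (R : finNzRingType) m n r (A : 'M[R]_(m, n)) :
  reflect (exists (B : 'M_(m, r)) (C : 'M_(r, n)), A = B *m C)
    (inner_rank A <= r)%N.
Proof.
apply: (iffP idP); rewrite /inner_rank; case: eqP => [-> _ | _] //.
- by exists 0, 0; rewrite mulmx0.
- case: ex_minnP => s /existsP[B /existsP[C /eqP ->]] _ le_sr.
  (* The factors are padded with zeros from inner size [s] to [r]. *)
  exists (B *m pid_mx s), (pid_mx s *m C).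
  by rewrite mulmxA -(mulmxA B) pid_mx_id // pid_mx_1 mulmx1.
case=> B [C A_BC]; case: ex_minnP => s _; apply.
by apply/existsP; exists B; apply/existsP; exists C; apply/eqP.
Qed.

Theorem theorem3p11 (h m n r : nat) (h_gt1 : (1 < h)%N)
  (r_ge1 : (1 <= r)%N) (r_le_m : (r <= m)%N) (m_le_n : (m <= n)%N) :
  [/\ chromatic_number (Sigma h m n r) = (h ^ (n * (m - r)))%N,
      clique_number (Sigma h m n r) = (h ^ (n * (m - r)))%N,
      independence_number (Bil h m n r) = (h ^ (n * (m - r)))%N &
    [/\ (exists S e', is_core_of (Sigma h m n r) S e'),
      (forall S e', is_core_of (Sigma h m n r) S e' ->
         (forall x y, x \in S -> y \in S -> x != y -> e' x y) /\
         #|S| = clique_number (Sigma h m n r)) &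
      ~ is_core_graph (Sigma h m n r)]].
Proof.
have n_gt0 : (0 < n)%N by rewrite (leq_trans r_ge1) // (leq_trans r_le_m).
move: m_le_n; rewrite -(subnKC r_le_m); move: (m - r)%N => k le_n {m r_le_m}.
rewrite addKn.
set e := Sigma h (r + k) n r.
have eE A B : e A B = (A != B) && (r < inner_rank (A - B))%N.
  by rewrite /e /Sigma /Bil; case: eqP => //= _; rewrite ltnNge.
have e_irr : irreflexive e by move=> A; rewrite eE eqxx.
have card_Zh : #|'Z_h| = h by rewrite card_ord Zp_cast.
have [G GP] := @mrd_code_Zp h r k n h_gt1 n_gt0 le_n.
pose code (c : 'rV['Z_h]_(k * n)) : 'M_(r + k, n) := vec_mx (c *m G).
have code_rank c d : c != d -> (r < inner_rank (code c - code d))%N.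
  apply: contraNltn => /inner_rank_leP[B [C]].
  by rewrite -linearB -mulmxBl => /GP/eqP; rewrite subr_eq0.
have code_inj : injective code.
  move=> c d eq_cd; apply/eqP; apply: contraTT isT => /code_rank.
  by rewrite eq_cd subrr /inner_rank eqxx.
pose K := code @: setT.
have K_clique : is_clique e K.
  apply/cliqueP => _ _ /imsetP[c _ ->] /imsetP[d _ ->] neq_cd.
  by rewrite eE neq_cd code_rank // (contraNneq _ neq_cd) // => ->.
have cardK : #|K| = (h ^ (n * k))%N.
  by rewrite card_imset // cardsT card_mx card_Zh mul1n mulnC.
have card_col : #|'M['Z_h]_(k, n)| = #|K|.
  by rewrite cardK card_mx card_Zh mulnC.
(* The colours are the lower blocks, exactly as many as the codewords. *)
pose col (A : 'M['Z_h]_(r + k, n)) := cast_ord card_col (enum_rank (dsubmx A)).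
have col_proper A B : e A B -> col A != col B.
  rewrite eE => /andP[_].
  apply: contraTneq => /cast_ord_inj/enum_rank_inj eq_AB.
  (* With equal lower blocks, [A - B] is its upper block of [r] rows above zeros, so it factors
     through [r]. *)
  rewrite -leqNgt; apply/inner_rank_leP.
  exists (col_mx 1%:M 0), (usubmx (A - B)).
  rewrite mul_col_mx mul1mx mul0mx -[LHS]vsubmxK; congr (col_mx _ _).
  by rewrite linearB /= eq_AB subrr.
rewrite (chromatic_number_clique e_irr K_clique col_proper).
rewrite (clique_number_clique e_irr K_clique col_proper) -cardK; split=> //.
  (* Independent sets of [Bil] are the cliques of [Sigma]. *)
  rewrite -(clique_number_clique e_irr K_clique col_proper).
  apply: eq_bigl => S; apply: eq_forallb => A; congr (_ ==> _).
  apply: eq_forallb => B; congr (_ ==> _).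
  by rewrite /e /Sigma; case: eqP.
split.
- exists K, [rel x y in K | x != y].
  exact: (clique_is_core K_clique col_proper 0).
- move=> S e' /(core_is_max_clique e_irr K_clique col_proper)[e'_clique ->].
  by split=> //; apply: (clique_number_clique e_irr K_clique col_proper).
apply: (small_clique_not_core K_clique col_proper).
(* There are [h ^ ((r + k) * n)] vertices, more than [#|K|] because [r] is positive. *)
rewrite cardK card_mx card_Zh ltn_exp2l // mulnC ltn_pmul2r //.
by rewrite -addn1 addnC leq_add2r.
Qed.
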